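(* Let $T$ be a hermitian asymmetric triple isomorphism of $\mathbb O$. Define $\widetilde{T}:C_6\to C_6$ by $$\widetilde{T}\begin{pmatrix} \alpha & a & b \\ a^\diamond & \beta & c \\ b^\diamond & c^\diamond & \gamma \end{pmatrix}=\begin{pmatrix} \alpha & T(a) & T(b)\boxdot T(1)^\diamond \\ T(a)^\diamond & \beta & T(c^\diamond)^\diamond \\ T(1)\boxdot T(b)^\diamond & T(c^\diamond) & \gamma \end{pmatrix}\qquad(\alpha,\beta,\gamma\in\mathbb C,\ a,b,c\in\mathbb O).$$ Then $\widetilde{T}$ is a Jordan $*$-automorphism of $C_6$.
   Context: Cayley–Dickson algebras: $\mathcal A_0=\mathbb C$ with its usual product, $x^{\diamond}=x$, $x^*=\overline{x}$. Inductively $\mathcal A_{n+1}=\mathcal A_n\times\mathcal A_n$ with $\overline{(x_1,x_2)}=(\overline{x_1},\overline{x_2})$, $(x_1,x_2)^{\diamond}=(x_1^{\diamond},-x_2)$, $(x_1,x_2)^*=(x_1^*,-\overline{x_2})$ and $(x_1,x_2)\boxdot(y_1,y_2)=(x_1\boxdot y_1-y_2\boxdot x_2^{\diamond},\ x_1^{\diamond}\boxdot y_2+y_1\boxdot x_2)$. Complex octonions: $\mathbb O=\mathcal A_3$; $a\in\mathcal A_n$ is identified with $(a,0)\in\mathcal A_{n+1}$. A complex-linear bijection $T:\mathbb O\to\mathbb O$ is a hermitian asymmetric triple isomorphism if $T((x\boxdot y^* )\boxdot z)=(T(x)\boxdot T(y)^* )\boxdot T(z)$ for all $x,y,z\in\mathbb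 O$ and $T(\overline x)=\overline{T(x)}$ for all $x\in\mathbb O$. For matrices over $\mathbb O$: $(x^\diamond)_{ij}=(x_{ji})^\diamond$, $(x^* )_{ij}=(x_{ji})^*$, and $\boxdot$ is the usual matrix product. The Cartan factor of type 6 is the JB$^*$-algebra $C_6=H_3(\mathbb O)=\{x\in M_3(\mathbb O): x^{\diamond}=x\}$ with Jordan product $x\circ y=\frac12(x\boxdot y+y\boxdot x)$ and involution $^*$. A Jordan $*$-automorphism is a complex-linear bijection preserving $\circ$ and $^*$. *)

(* Defs.v *)
From HB Require Import structures.
From mathcomp Require Import all_boot all_order all_algebra.
From mathcomp Require Export reals complex.

Set Implicit Arguments.
Unset Strict Implicit.
Unset Printing Implicit Defensive.

Import Order.TTheory GRing.Theory Num.Theory.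

Local Open Scope ring_scope.

(** Everything below is stated over an abstract [C : numClosedFieldType]; the
    theorem uses the complex numbers [C := R[i]] with [R : realType]. *)

Section CayleyDickson.
Variable C : numClosedFieldType.

Fixpoint cd (n : nat) : lmodType C :=
  if n is m.+1 then (cd m * cd m)%type else C^o.

Fixpoint cdconj (n : nat) : cd n -> cd n :=
  match n return cd n -> cd n with
  | 0 => fun x : C => x^*
  | m.+1 => fun x : cd m * cd m => (cdconj x.1, cdconj x.2)
  end.

Fixpoint cddia (n : nat) : cd n -> cd n :=
  match n return cd n -> cd n with
  | 0 => fun x : C => x
  | m.+1 => fun x : cd m * cd m => (cddia x.1, - x.2)
  end.

Fixpoint cdstar (n : nat) : cd n -> cd n :=
  match n return cd n -> cd n with
  | 0 => fun x : C => x^*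
  | m.+1 => fun x : cd m * cd m => (cdstar x.1, - cdconj x.2)
  end.

Fixpoint cdmul (n : nat) : cd n -> cd n -> cd n :=
  match n return cd n -> cd n -> cd n with
  | 0 => fun x y : C => x * y
  | m.+1 => fun x y : cd m * cd m =>
      (cdmul x.1 y.1 - cdmul y.2 (cddia x.2),
       cdmul (cddia x.1) y.2 + cdmul y.1 x.2)
  end.

(** The iterated identification of [a] with [(a, 0)]. *)
Fixpoint cdscal (n : nat) (a : C) : cd n :=
  match n return cd n with
  | 0 => a
  | m.+1 => (cdscal m a, 0)
  end.

Fixpoint cdcoef0 (n : nat) : cd n -> C :=
  match n return cd n -> C with
  | 0 => fun x : C => x
  | m.+1 => fun x : cd m * cd m => cdcoef0 x.1
  end.

Lemma cddia_fixedP n (x : cd n) : cddia x = x -> x = cdscal n (cdcoef0 x).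
Proof.
elim: n x => [|n IH] //= -[x y] /= [/IH <- ny].
suff -> : y = 0 by [].
have : (2%:R : C) *: y = 0 by rewrite scaler_nat mulr2n -{1}ny addNr.
by move/(congr1 ( *:%R 2^-1)); rewrite scalerA mulVf ?pnatr_eq0 // scale1r scaler0.
Qed.

Lemma cdconj_linear n (x y : cd n) (a : C) :
  cdconj (a *: x + y) = a^* *: cdconj x + cdconj y.
Proof.
elim: n x y => [|n IH] x y /=; first by rewrite rmorphD rmorphM.
by rewrite !IH.
Qed.

Lemma cdconjD n : {morph @cdconj n : x y / x + y}.
Proof. by move=> x y; have := cdconj_linear x y 1; rewrite conjC1 !scale1r. Qed.

Lemma cdconj0 n : cdconj (0 : cd n) = 0.
Proof. by apply: (addrI (cdconj 0)); rewrite -cdconjD !addr0. Qed.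

Lemma cdconjN n : {morph @cdconj n : x / - x}.
Proof.
by move=> x; apply: (addrI (cdconj x)); rewrite -cdconjD !subrr cdconj0.
Qed.

Lemma cddia_linear n : linear (@cddia n).
Proof.
elim: n => [|n IH] a x y //=; rewrite IH; congr pair.
by rewrite opprD -scalerN.
Qed.

Lemma cddiaD n : {morph @cddia n : x y / x + y}.
Proof. by move=> x y; have := cddia_linear 1 x y; rewrite !scale1r. Qed.

Lemma cddia0 n : cddia (0 : cd n) = 0.
Proof. by apply: (addrI (cddia 0)); rewrite -cddiaD !addr0. Qed.

Lemma cddiaN n : {morph @cddia n : x / - x}.
Proof.
by move=> x; apply: (addrI (cddia x)); rewrite -cddiaD !subrr cddia0.
Qed.

Lemma cddiaZ n (a : C) (x : cd n) : cddia (a *: x) = a *: cddia x.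
Proof. by have := cddia_linear a x 0; rewrite cddia0 !addr0. Qed.

Lemma cddiaK n : involutive (@cddia n).
Proof. by elim: n => [|n IH] //= [x y]; rewrite /= IH opprK. Qed.

Lemma cddia_scal n (a : C) : cddia (cdscal n a) = cdscal n a.
Proof. by elim: n => //= n ->; rewrite oppr0. Qed.

Lemma cddia_conj n (x : cd n) : cddia (cdconj x) = cdconj (cddia x).
Proof. by elim: n x => [|n IH] //= x; rewrite IH cdconjN. Qed.

Lemma cddia_star n (x : cd n) : cddia (cdstar x) = cdstar (cddia x).
Proof. by elim: n x => [|n IH] //= x; rewrite IH cdconjN. Qed.

Lemma cdmul_bilinear n (z : cd n) :
  linear (@cdmul n ^~ z) /\ linear (@cdmul n z).
Proof.
elim: n z => [|n IH] z.
  by split=> a x y; rewrite /= ?mulrDl ?mulrDr /GRing.scale /= ?mulrA // [z * a]mulrC.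
have mulDZl (u v w : cd n) a : cdmul (a *: u + v) w = a *: cdmul u w + cdmul v w.
  by have [H _] := IH w; exact: H.
have mulDZr (u v w : cd n) a : cdmul w (a *: u + v) = a *: cdmul w u + cdmul w v.
  by have [_ H] := IH w; exact: H.
split=> a x y /=; congr pair; rewrite ?cddia_linear /= ?(mulDZl, mulDZr).
- by rewrite opprD addrACA -scalerBr.
- by rewrite addrACA -scalerDr.
- by rewrite opprD addrACA -scalerBr.
- by rewrite addrACA -scalerDr.
Qed.

Lemma cdmul_linearl n (z : cd n) : linear (@cdmul n ^~ z).
Proof. exact: (cdmul_bilinear z).1. Qed.

Lemma cdmul_linearr n (z : cd n) : linear (@cdmul n z).
Proof. exact: (cdmul_bilinear z).2. Qed.

Lemma cdmulNl n (x y : cd n) : cdmul (- x) y = - cdmul x y.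
Proof.
have mulDl u v : cdmul (u + v) y = cdmul u y + cdmul v y.
  by have := cdmul_linearl y 1 u v; rewrite !scale1r.
have mul0 : cdmul 0 y = 0.
  by apply: (addrI (cdmul 0 y)); rewrite -mulDl !addr0.
by apply: (addrI (cdmul x y)); rewrite -mulDl !subrr.
Qed.

Lemma cdmulNr n (x y : cd n) : cdmul x (- y) = - cdmul x y.
Proof.
have mulDr u v : cdmul x (u + v) = cdmul x u + cdmul x v.
  by have := cdmul_linearr x 1 u v; rewrite !scale1r.
have mul0 : cdmul x 0 = 0.
  by apply: (addrI (cdmul x 0)); rewrite -mulDr !addr0.
by apply: (addrI (cdmul x y)); rewrite -mulDr !subrr.
Qed.

Lemma cddiaM n (x y : cd n) : cddia (cdmul x y) = cdmul (cddia y) (cddia x).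
Proof.
elim: n x y => [|n IH] x y /=; first exact: mulrC.
rewrite !cddiaD !cddiaN !IH !cddiaK; congr pair.
  by rewrite cdmulNl cdmulNr opprK.
by rewrite !cdmulNr opprD addrC.
Qed.

End CayleyDickson.

Notation oct C := (cd C 3).

Declare Scope cd_scope.
Delimit Scope cd_scope with CD.
Notation "x ⊡ y" := (cdmul x y) (at level 40, left associativity) : cd_scope.
Notation "x ^⋄" := (cddia x) (at level 2, left associativity, format "x ^⋄")
  : cd_scope.
Notation "x ^⋆" := (cdstar x) (at level 2, left associativity, format "x ^⋆")
  : cd_scope.

Section TripleIsomorphism.
Variable C : numClosedFieldType.

Record hermitian_asymmetric_triple_iso (T : oct C -> oct C) : Prop := {
  hati_linear : linear T;
  hati_bij : bijective T;
  hati_triple : forall x y z : oct C,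
    T ((x ⊡ y^⋆) ⊡ z)%CD = ((T x ⊡ (T y)^⋆) ⊡ T z)%CD;
  hati_conj : forall x : oct C, T (cdconj x) = cdconj (T x)
}.

End TripleIsomorphism.

Section HermitianMatrices.
Variables (C : numClosedFieldType) (n : nat).

(** ['M[cd C n]_m] is only a [zmodType] in the library, since [cd C n] is not a
    ring in its sense; the alias [cdmx] carries the entrywise [C]-module
    structure. *)
Definition cdmx (m : nat) : Type := 'M[cd C n]_m.
HB.instance Definition _ m := GRing.Zmodule.on (cdmx m).

Section SquareMatrices.
Variable m : nat.
Implicit Types x y : 'M[cd C n]_m.

Definition cdmx_scale (a : C) x : 'M[cd C n]_m := \matrix_(i, j) (a *: x i j).

Definition cdmx_dia x : 'M[cd C n]_m := \matrix_(i, j) ((x j i)^⋄)%CD.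

Definition cdmx_star x : 'M[cd C n]_m := \matrix_(i, j) ((x j i)^⋆)%CD.

Definition cdmx_mul x y : 'M[cd C n]_m :=
  \matrix_(i, j) \sum_k (x i k ⊡ y k j)%CD.

Definition cdmx_jmul x y : 'M[cd C n]_m :=
  cdmx_scale 2^-1 (cdmx_mul x y + cdmx_mul y x).

Lemma cdmx_scaleA a b x : cdmx_scale a (cdmx_scale b x) = cdmx_scale (a * b) x.
Proof. by apply/matrixP => i j; rewrite !mxE scalerA. Qed.

Lemma cdmx_scale1 : left_id 1 cdmx_scale.
Proof. by move=> x; apply/matrixP => i j; rewrite !mxE scale1r. Qed.

Lemma cdmx_scaleDr : right_distributive cdmx_scale +%R.
Proof. by move=> a x y; apply/matrixP => i j; rewrite !mxE scalerDr. Qed.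

Lemma cdmx_scaleDl x : {morph cdmx_scale^~ x : a b / a + b}.
Proof. by move=> a b; apply/matrixP => i j; rewrite !mxE scalerDl. Qed.

HB.instance Definition _ := GRing.Zmodule_isLmodule.Build C (cdmx m)
  cdmx_scaleA cdmx_scale1 cdmx_scaleDr cdmx_scaleDl.

Definition herm_cdmx : {pred cdmx m} := [pred x : cdmx m | cdmx_dia x == x].

Lemma herm_cdmxP (x : cdmx m) :
  reflect (forall i j, (((x : 'M_m) j i)^⋄)%CD = (x : 'M_m) i j)
          (x \in herm_cdmx).
Proof.
apply: (iffP eqP) => [hx i j | hx].
  by move/matrixP: hx => /(_ i j); rewrite mxE.
by apply/matrixP => i j; rewrite mxE.
Qed.

Lemma herm_cdmx_submod : submod_closed herm_cdmx.
Proof.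
split=> [|a x y /herm_cdmxP hx /herm_cdmxP hy].
  by apply/herm_cdmxP => i j; rewrite !mxE cddia0.
by apply/herm_cdmxP => i j; rewrite !mxE cddia_linear hx hy.
Qed.

HB.instance Definition _ :=
  GRing.isSubmodClosed.Build C (cdmx m) herm_cdmx herm_cdmx_submod.

Lemma cdmx_jmul_herm (x y : cdmx m) :
  x \in herm_cdmx -> y \in herm_cdmx -> (cdmx_jmul x y : cdmx m) \in herm_cdmx.
Proof.
move=> /herm_cdmxP hx /herm_cdmxP hy; apply/herm_cdmxP => i j.
rewrite !mxE cddiaZ cddiaD !(big_morph _ (@cddiaD C n) (@cddia0 C n)) addrC.
congr (_ *: (_ + _)).
  by apply: eq_bigr => k _; rewrite cddiaM hx hy.
by apply: eq_bigr => k _; rewrite cddiaM hx hy.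
Qed.

Lemma cdmx_star_herm (x : cdmx m) :
  x \in herm_cdmx -> (cdmx_star x : cdmx m) \in herm_cdmx.
Proof.
by move=> /herm_cdmxP hx; apply/herm_cdmxP => i j; rewrite !mxE cddia_star hx.
Qed.

End SquareMatrices.

Record herm3 : Type := Herm3 { herm3mx : cdmx 3; _ : herm3mx \in @herm_cdmx 3 }.

HB.instance Definition _ := [isSub for herm3mx].
HB.instance Definition _ := [Choice of herm3 by <:].
HB.instance Definition _ := [SubChoice_isSubLmodule of herm3 by <:].

Definition herm3_jmul (x y : herm3) : herm3 :=
  Herm3 (cdmx_jmul_herm (valP x) (valP y)).

Definition herm3_star (x : herm3) : herm3 := Herm3 (cdmx_star_herm (valP x)).

Record jordan_star_automorphism (F : herm3 -> herm3) : Prop := {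
  jsa_linear : linear F;
  jsa_bij : bijective F;
  jsa_jmul : {morph F : x y / herm3_jmul x y};
  jsa_star : {morph F : x / herm3_star x}
}.

Definition mx33 (a11 a12 a13 a21 a22 a23 a31 a32 a33 : cd C n) : 'M[cd C n]_3 :=
  \matrix_(i, j)
    (nth [::] [:: [:: a11; a12; a13]; [:: a21; a22; a23]; [:: a31; a32; a33]] i)`_j.

Definition herm33 (alpha beta gamma : C) (a b c : cd C n) : 'M[cd C n]_3 :=
  mx33 (cdscal n alpha) a                b
       (a^⋄)%CD         (cdscal n beta)  c
       (b^⋄)%CD         (c^⋄)%CD         (cdscal n gamma).

Lemma herm33_herm alpha beta gamma a b c :
  (herm33 alpha beta gamma a b c : cdmx 3) \in @herm_cdmx 3.
Proof.
apply/herm_cdmxP; do 2![case; case=> [|[|[|//]]] ?].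
all: by rewrite !mxE /= ?cddia_scal ?cddiaK.
Qed.

Definition herm3_of alpha beta gamma a b c : herm3 :=
  Herm3 (herm33_herm alpha beta gamma a b c).

Lemma herm3P (x : herm3) : exists alpha beta gamma a b c,
  x = herm3_of alpha beta gamma a b c.
Proof.
have ord3P (i : 'I_3) : [\/ i = 0, i = 1 | i = 2].
  by case: i => [[|[|[|//]]] p];
    [constructor 1 | constructor 2 | constructor 3]; apply: val_inj.
case: x => x xH; pose y : 'M[cd C n]_3 := x.
have hy i j : ((y j i)^⋄)%CD = y i j by move: i j; exact/herm_cdmxP.
have d k := cddia_fixedP (hy k k).
exists (cdcoef0 (y 0 0)), (cdcoef0 (y 1 1)), (cdcoef0 (y 2 2)),
  (y 0 1), (y 0 2), (y 1 2).
apply: val_inj; apply/matrixP => i j; rewrite mxE -/(y i j).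
by case: (ord3P i) => ->; case: (ord3P j) => -> /=; rewrite -?d ?hy.
Qed.

(** Reads the entries of a hermitian matrix, with [a], [b], [c] the entries
    above the diagonal and [alpha], [beta], [gamma] (as scalars of [cd C n]) the
    diagonal ones; [tilde_herm3_of] below is the defining formula. *)
Definition tilde_mx (T : cd C n -> cd C n) (x : 'M[cd C n]_3) : 'M[cd C n]_3 :=
  let one : cd C n := cdscal n 1 in
  let a := x 0 1 in let b := x 0 2 in let c := x 1 2 in
  mx33 (x 0 0)                (T a)              (T b ⊡ (T one)^⋄)%CD
       ((T a)^⋄)%CD           (x 1 1)            ((T (c^⋄))^⋄)%CD
       (T one ⊡ (T b)^⋄)%CD   (T (c^⋄)%CD)       (x 2 2).

Lemma tilde_mx_herm T (x : cdmx 3) :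
  x \in @herm_cdmx 3 -> (tilde_mx T x : cdmx 3) \in @herm_cdmx 3.
Proof.
move=> /herm_cdmxP hx.
apply/herm_cdmxP; do 2![case; case=> [|[|[|//]]] ?].
all: by rewrite !mxE /= ?cddiaM ?cddiaK ?hx.
Qed.

Definition tilde (T : cd C n -> cd C n) (x : herm3) : herm3 :=
  Herm3 (tilde_mx_herm T (valP x)).

Lemma tilde_herm3_of T alpha beta gamma a b c :
  herm3mx (tilde T (herm3_of alpha beta gamma a b c)) =
  let one : cd C n := cdscal n 1 in
  mx33 (cdscal n alpha)       (T a)              (T b ⊡ (T one)^⋄)%CD
       ((T a)^⋄)%CD           (cdscal n beta)    ((T (c^⋄))^⋄)%CD
       (T one ⊡ (T b)^⋄)%CD   (T (c^⋄)%CD)       (cdscal n gamma).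
Proof. by rewrite /= /tilde_mx !mxE. Qed.

End HermitianMatrices.

Notation C6 C := (herm3 C 3).

(* Main.v *)
(** Since [y^⋆] is the complex conjugate of [y^⋄] and [T] commutes with complex
    conjugation, [T ((x ⊡ y^⋄) ⊡ z) = (T x ⊡ (T y)^⋄) ⊡ T z].  Polarizing the
    scalar [x ⊡ x^⋄] shows that [T] preserves the bilinear form of the
    octonions, so that [u = T 1] has norm 1 and right multiplication by [u] is
    inverse to right multiplication by [u^⋄].  Each entry of [tilde T (x ∘ y)]
    above the diagonal is then the triple identity with one argument equal to 1,
    and each diagonal entry is the invariance of the bilinear form. *)

Require Import Defs.
From mathcomp Require Import all_boot all_order all_algebra.
From mathcomp Require Import reals complex.
From mathcomp Require Import ring.

Import GRing.Theory Num.Theory.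
Local Open Scope ring_scope.
Local Open Scope cd_scope.

Section Algebra.
Variable C : numClosedFieldType.

(** * Bilinearity, unit and conjugation in every degree *)

Section AnyDegree.
Variable n : nat.
Implicit Types (x y z : cd C n) (a b : C).

Lemma cdmulDl x y z : (x + y) ⊡ z = x ⊡ z + y ⊡ z.
Proof. by have := cdmul_linearl z 1 x y; rewrite !scale1r. Qed.

Lemma cdmulDr x y z : z ⊡ (x + y) = z ⊡ x + z ⊡ y.
Proof. by have := cdmul_linearr z 1 x y; rewrite !scale1r. Qed.

Lemma cdmul0 x : x ⊡ 0 = 0.
Proof. by apply: (addrI (x ⊡ 0)); rewrite -cdmulDr !addr0. Qed.

Lemma cd0mul x : 0 ⊡ x = 0.
Proof. by apply: (addrI (0 ⊡ x)); rewrite -cdmulDl !addr0. Qed.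

Lemma cdmulZl a x y : (a *: x) ⊡ y = a *: (x ⊡ y).
Proof. by have := cdmul_linearl y a x 0; rewrite cd0mul !addr0. Qed.

Lemma cdmulZr a x y : x ⊡ (a *: y) = a *: (x ⊡ y).
Proof. by have := cdmul_linearr x a y 0; rewrite cdmul0 !addr0. Qed.

End AnyDegree.

Lemma cdscal_linear n (a b c : C) :
  cdscal n (a * b + c) = a *: cdscal n b + cdscal n c.
Proof.
elim: n => //= n IH; congr pair; first exact: IH.
by rewrite /= scaler0 addr0.
Qed.

Lemma cdscal0 n : cdscal n (0 : C) = 0.
Proof. by elim: n => //= n ->. Qed.

Lemma cdscalD n (a b : C) : cdscal n (a + b) = cdscal n a + cdscal n b.
Proof. by have := cdscal_linear n 1 a b; rewrite mul1r scale1r. Qed.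

Lemma cdscalZ n (a b : C) : cdscal n (a * b) = a *: cdscal n b.
Proof. by have := cdscal_linear n a b 0; rewrite cdscal0 !addr0. Qed.

Lemma cdconj_scal n (a : C) : cdconj (cdscal n a) = cdscal n a^*.
Proof. by elim: n => //= n ->; rewrite cdconj0. Qed.

Lemma cdcoef0_linear n a (x y : cd C n) :
  cdcoef0 (a *: x + y) = a * cdcoef0 x + cdcoef0 y.
Proof. by elim: n x y => [|n IH] x y //=; rewrite IH. Qed.

Lemma cdcoef0D n (x y : cd C n) : cdcoef0 (x + y) = cdcoef0 x + cdcoef0 y.
Proof. by have := cdcoef0_linear n 1 x y; rewrite scale1r mul1r. Qed.

Lemma cdcoef0N n (x : cd C n) : cdcoef0 (- x) = - cdcoef0 x.
Proof.
have h0 : cdcoef0 (0 : cd C n) = 0.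
  by apply: (addrI (cdcoef0 (0 : cd C n))); rewrite -cdcoef0D !addr0.
by apply: (addrI (cdcoef0 x)); rewrite -cdcoef0D !subrr.
Qed.

Lemma cdcoef0_dia n (x : cd C n) : cdcoef0 x^⋄ = cdcoef0 x.
Proof. by elim: n x => //= n IH x; rewrite IH. Qed.

(** Both laws go through one induction: the right unit law in degree [n.+1] uses the left one in
    degree [n]. *)
Lemma cdmul1_scal n (x : cd C n) : cdscal n 1 ⊡ x = x /\ x ⊡ cdscal n 1 = x.
Proof.
elim: n x => [|n IH] x /=; first by rewrite mul1r mulr1.
have lft z := (IH z).1; have rgt z := (IH z).2.
case: x => x y /=; rewrite cddia_scal cddia0 !cdmul0 !cd0mul !lft !rgt.
by rewrite !subr0 addr0 add0r.
Qed.

Lemma cd1mul n (x : cd C n) : cdscal n 1 ⊡ x = x.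
Proof. exact: (cdmul1_scal n x).1. Qed.

Lemma cdmul1 n (x : cd C n) : x ⊡ cdscal n 1 = x.
Proof. exact: (cdmul1_scal n x).2. Qed.

Lemma cdscal_mul n a (x : cd C n) : cdscal n a ⊡ x = a *: x.
Proof. by rewrite -[a]mulr1 cdscalZ cdmulZl cd1mul mulr1. Qed.

Lemma cdmul_scal n a (x : cd C n) : x ⊡ cdscal n a = a *: x.
Proof. by rewrite -[a]mulr1 cdscalZ cdmulZr cdmul1 mulr1. Qed.

Lemma cdstarE n (x : cd C n) : x^⋆ = cdconj x^⋄.
Proof. by elim: n x => //= n IH x; rewrite IH cdconjN. Qed.

Lemma cdconjK n : involutive (@cdconj C n).
Proof.
elim: n => [|n IH] x; first exact: conjCK.
by case: x => x y; rewrite /= !IH.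
Qed.

Lemma cdconjM n (x y : cd C n) : cdconj (x ⊡ y) = cdconj x ⊡ cdconj y.
Proof.
elim: n x y => [|n IH] x y; first exact: rmorphM.
by rewrite /= !(cdconjD, cdconjN, IH, cddia_conj).
Qed.

(** * Scalar part and bilinear form *)

Lemma cdcoef0_mulC n (x y : cd C n) : cdcoef0 (x ⊡ y) = cdcoef0 (y ⊡ x).
Proof.
elim: n x y => [|n IH] x y /=; first exact: mulrC.
rewrite !cdcoef0D !cdcoef0N IH; congr (_ - _).
(* The two remaining products are exchanged by [⋄], which preserves the scalar part. *)
by rewrite -[LHS]cdcoef0_dia cddiaM cddiaK.
Qed.

(* Associativity under [cdcoef0] holds in every degree, although the product
   itself is not associative from degree 3 on. *)
Lemma cdcoef0_mulA n (x y z : cd C n) :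
  cdcoef0 ((x ⊡ y) ⊡ z) = cdcoef0 (x ⊡ (y ⊡ z)).
Proof.
elim: n x y z => [|n IH] x y z /=; first by rewrite mulrA.
rewrite !(cddiaD, cdmulDl, cdmulDr, cddiaM, cddiaK, cdmulNl, cdmulNr).
rewrite !(cdcoef0D, cdcoef0N) IH.
(* Cyclic rotation brings the triple products of components on both sides to the same form. *)
have cyc (p q r : cd C n) : cdcoef0 ((p ⊡ q) ⊡ r) = cdcoef0 ((r ⊡ p) ⊡ q).
  by rewrite cdcoef0_mulC IH.
rewrite (cyc y.2 _ z.1) -!IH.
rewrite [cdcoef0 (_ ⊡ _ ⊡ x.1)]cyc [cdcoef0 (_ ⊡ _ ⊡ y.1^⋄)]cyc.
by ring.
Qed.

(** Complex bilinear, not sesquilinear: the polar form of the norm given by [x ⊡ x^⋄]. *)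
Definition cdform {n} (x y : cd C n) : C := cdcoef0 (x ⊡ y^⋄).

Lemma cdformC n (x y : cd C n) : cdform x y = cdform y x.
Proof. by rewrite /cdform -[LHS]cdcoef0_dia cddiaM cddiaK. Qed.

Lemma cdform_dia n (x y : cd C n) : cdform x^⋄ y^⋄ = cdform x y.
Proof. by rewrite /cdform cddiaK cdcoef0_mulC -/(cdform y x) cdformC. Qed.

(** The sum is fixed by [⋄], hence a scalar, and [cdcoef0] reads it off. *)
Lemma cdmul_diaD n (x y : cd C n) :
  x ⊡ y^⋄ + y ⊡ x^⋄ = cdscal n (2 * cdform x y).
Proof.
have fix_xy : (x ⊡ y^⋄ + y ⊡ x^⋄)^⋄ = x ⊡ y^⋄ + y ⊡ x^⋄.
  by rewrite cddiaD !cddiaM !cddiaK addrC.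
rewrite (cddia_fixedP fix_xy) cdcoef0D.
by rewrite -!/(cdform _ _) [cdform y x]cdformC mulr_natl mulr2n.
Qed.

Lemma cddia_mulD n (x y : cd C n) :
  x^⋄ ⊡ y + y^⋄ ⊡ x = cdscal n (2 * cdform x y).
Proof. by rewrite -cdform_dia -cdmul_diaD !cddiaK. Qed.

(** Right alternativity of the octonions, checked as a polynomial identity in each of the eight
    coordinates. *)
Lemma octmul_diaK (x u : oct C) : (x ⊡ u) ⊡ u^⋄ = cdform u u *: x.
Proof.
case: x u => [[[x1 x2] [x3 x4]] [[x5 x6] [x7 x8]]].
case=> [[[u1 u2] [u3 u4]] [[u5 u6] [u7 u8]]].
rewrite /cdform /=.
congr (((_, _), (_, _)), ((_, _), (_, _))); rewrite /= /GRing.scale /=; ring.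
Qed.

End Algebra.

Arguments cdform {C n}.

Section Isomorphism.
Variable C : numClosedFieldType.
Local Notation one := (cdscal 3 (1 : C)).

(** * Consequences of the triple identity *)

Section TripleIso.
Variable T : oct C -> oct C.
Hypothesis hT : hermitian_asymmetric_triple_iso T.
Implicit Types x y z : oct C.
Local Notation u := (T one).

Lemma hatiD x y : T (x + y) = T x + T y.
Proof. by have := hati_linear hT 1 x y; rewrite !scale1r. Qed.

Lemma hati0 : T 0 = 0.
Proof. by apply: (addrI (T 0)); rewrite -hatiD !addr0. Qed.

Lemma hatiZ a x : T (a *: x) = a *: T x.
Proof. by have := hati_linear hT a x 0; rewrite hati0 !addr0. Qed.

Lemma hati_triple_dia x y z : T ((x ⊡ y^⋄) ⊡ z) = (T x ⊡ (T y)^⋄) ⊡ T z.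
Proof.
have := hati_triple hT x (cdconj y) z.
by rewrite !cdstarE (hati_conj hT) !cddia_conj !cdconjK.
Qed.

(** Setting the middle, last or first argument to 1, here and in the next two lemmas, serves the
    entries [a], [b] and [c] respectively. *)
Lemma hati_mul x z : T (x ⊡ z) = (T x ⊡ u^⋄) ⊡ T z.
Proof. by rewrite -hati_triple_dia cddia_scal cdmul1. Qed.

Lemma hati_mul_dia x y : T (x ⊡ y^⋄) = (T x ⊡ (T y)^⋄) ⊡ u.
Proof. by rewrite -hati_triple_dia cdmul1. Qed.

Lemma hati_dia_mul y z : T (y^⋄ ⊡ z) = (u ⊡ (T y)^⋄) ⊡ T z.
Proof. by rewrite -hati_triple_dia cd1mul. Qed.

Lemma hati_conj_one : cdconj u = u.
Proof. by rewrite -(hati_conj hT) cdconj_scal conjC1. Qed.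

Lemma hati_one_neq0 : u != 0.
Proof.
apply/eqP; rewrite -hati0 => /(bij_inj (hati_bij hT)) /(congr1 (@cdcoef0 C 3)).
by move/eqP; rewrite /= oner_eq0.
Qed.

(** The symmetrized triple identity with last argument 1 equates two multiples of [u], and [u] is
    nonzero. *)
Lemma hati_form x y : cdform (T x) (T y) = cdform x y.
Proof.
have : T ((x ⊡ y^⋄ + y ⊡ x^⋄) ⊡ one) =
    (T x ⊡ (T y)^⋄ + T y ⊡ (T x)^⋄) ⊡ u.
  by rewrite !cdmulDl hatiD !hati_triple_dia.
rewrite !cdmul_diaD !cdscal_mul hatiZ => /eqP.
rewrite -subr_eq0 -scalerBl scaler_eq0 (negPf hati_one_neq0) orbF subr_eq0.
by move/eqP/(mulfI _) => -> //; rewrite pnatr_eq0.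
Qed.

Lemma hati_one_form : cdform u u = 1.
Proof. by rewrite hati_form /cdform cddia_scal cdmul1. Qed.

Lemma hati_oneK x : (x ⊡ u) ⊡ u^⋄ = x.
Proof. by rewrite octmul_diaK hati_one_form scale1r. Qed.

Lemma hati_one_diaK x : (x ⊡ u^⋄) ⊡ u = x.
Proof. by rewrite -{2}[u]cddiaK octmul_diaK cdform_dia hati_one_form scale1r. Qed.

(** Associativity under [cdcoef0] moves [u] next to [x ⊡ u^⋄], where it cancels. *)
Lemma cdform_mul_one_dia x y : cdform (x ⊡ u^⋄) (y ⊡ u^⋄) = cdform x y.
Proof. by rewrite /cdform cddiaM cddiaK -cdcoef0_mulA hati_one_diaK. Qed.

End TripleIso.

Lemma hati_inv (T S : oct C -> oct C) :
  hermitian_asymmetric_triple_iso T -> cancel T S -> cancel S T ->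
  hermitian_asymmetric_triple_iso S.
Proof.
move=> hT TK SK; have Tinj := can_inj TK; split.
- by move=> a x y; apply: Tinj; rewrite (hati_linear hT) !SK.
- by exists T.
- by move=> x y z; apply: Tinj; rewrite (hati_triple hT) !SK.
- by move=> x; apply: Tinj; rewrite (hati_conj hT) !SK.
Qed.

(** * Coordinates on hermitian 3 by 3 matrices *)

Lemma ord3P (i : 'I_3) : [\/ i = 0, i = 1 | i = 2].
Proof.
by case: i => [[|[|[|//]]] p];
  [constructor 1 | constructor 2 | constructor 3]; apply: val_inj.
Qed.

Lemma herm3_entry n (x : herm3 C n) i j :
  ((herm3mx x : 'M_3) j i)^⋄ = (herm3mx x : 'M_3) i j.
Proof. by move: i j; apply/herm_cdmxP; exact: (valP x). Qed.

Lemma herm3_eq n (x y : herm3 C n) :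
  (forall i j : 'I_3, (i <= j)%N ->
     (herm3mx x : 'M_3) i j = (herm3mx y : 'M_3) i j) -> x = y.
Proof.
move=> exy; apply: val_inj; apply/matrixP => i j.
have [/exy //|/ltnW/exy eji] := leqP i j.
by rewrite -(herm3_entry n x) -(herm3_entry n y) eji.
Qed.

Lemma tildeE n (T : cd C n -> cd C n) (a b c : cd C n) (al be ga : C) :
  tilde T (herm3_of al be ga a b c) =
  herm3_of al be ga (T a) (T b ⊡ (T (cdscal n 1))^⋄) (T c^⋄)^⋄.
Proof.
apply: val_inj; rewrite [LHS]tilde_herm3_of /= /herm33.
by rewrite cddiaM !cddiaK.
Qed.

(** On a hermitian matrix [⋄] and the transposition undo each other, leaving entrywise
    conjugation. *)
Lemma herm3_starE n al be ga (a b c : cd C n) :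
  herm3_star (herm3_of al be ga a b c) =
  herm3_of al^* be^* ga^* (cdconj a) (cdconj b) (cdconj c).
Proof.
apply: herm3_eq => i j; rewrite !mxE cdstarE.
by case: (ord3P i) => ->; case: (ord3P j) => -> //= _;
  rewrite ?cddiaK ?cddia_scal ?cdconj_scal.
Qed.

Lemma herm3_linearE n s al be ga al' be' ga' (a b c a' b' c' : cd C n) :
  s *: herm3_of al be ga a b c + herm3_of al' be' ga' a' b' c' =
  herm3_of (s * al + al') (s * be + be') (s * ga + ga')
    (s *: a + a') (s *: b + b') (s *: c + c').
Proof.
apply: herm3_eq => i j; rewrite !mxE.
by case: (ord3P i) => ->; case: (ord3P j) => -> //= _; rewrite ?cdscal_linear.
Qed.

Lemma herm3_jmulE n al be ga al' be' ga' (a b c a' b' c' : cd C n) :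
  herm3_jmul (herm3_of al be ga a b c) (herm3_of al' be' ga' a' b' c') =
  herm3_of (al * al' + cdform a a' + cdform b b')
           (be * be' + cdform a a' + cdform c c')
           (ga * ga' + cdform b b' + cdform c c')
    (2^-1 *: ((al + be) *: a' + (al' + be') *: a + (b ⊡ c'^⋄ + b' ⊡ c^⋄)))
    (2^-1 *: ((al + ga) *: b' + (al' + ga') *: b + (a ⊡ c' + a' ⊡ c)))
    (2^-1 *: ((be + ga) *: c' + (be' + ga') *: c + (a^⋄ ⊡ b' + a'^⋄ ⊡ b))).
Proof.
(* On the diagonal each off-diagonal product meets its mirror image, and the factor 1/2 absorbs the
   2 from polarization. *)
have diag (s t : C) (x x' y y' : cd C n) (p q : C) :
    x + x' = cdscal n (2 * p) -> y + y' = cdscal n (2 * q) ->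
    2^-1 *: (s *: cdscal n t + x + y + (t *: cdscal n s + x' + y')) =
    cdscal n (s * t + p + q).
  move=> xx yy; rewrite addrACA (addrACA (s *: _)) xx yy -!cdscalZ -!cdscalD.
  by rewrite -cdscalZ; congr cdscal; field.
apply: herm3_eq => i j; rewrite !mxE !big_ord_recl !big_ord0 !mxE.
case: (ord3P i) => ->; case: (ord3P j) => -> //= _.
all: rewrite ?cdscal_mul ?cdmul_scal ?addr0.
(* Terms 1 to 3 come from one order of the product, 4 to 6 from the other; the permutations put
   scalar multiples first. *)
- by rewrite [X in _ *: X](AC (1*2*(1*2)) (1*2*3*(4*5*6)));
    apply: diag; rewrite cdmul_diaD.
- by congr (_ *: _); rewrite !scalerDl [LHS](AC (1*2*(1*2)) (1*5*(4*2)*(3*6))).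
- by congr (_ *: _); rewrite !scalerDl [LHS](AC (1*2*(1*2)) (1*6*(4*3)*(2*5))).
- by rewrite [X in _ *: X](AC (1*2*(1*2)) (2*1*3*(5*4*6)));
    apply: diag; rewrite (cdmul_diaD, cddia_mulD).
- by congr (_ *: _); rewrite !scalerDl [LHS](AC (1*2*(1*2)) (2*6*(5*3)*(1*4))).
- by rewrite [X in _ *: X](AC (1*2*(1*2)) (3*1*2*(6*4*5)));
    apply: diag; rewrite cddia_mulD.
Qed.

(** * The automorphism property *)

Theorem tilde_automorphism (T : oct C -> oct C) :
  hermitian_asymmetric_triple_iso T ->
  jordan_star_automorphism (tilde T : C6 C -> C6 C).
Proof.
move=> hT.
have tildeK (F G : oct C -> oct C) : hermitian_asymmetric_triple_iso F ->
    hermitian_asymmetric_triple_iso G -> cancel F G -> cancel G F ->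
    cancel (tilde G : C6 C -> C6 C) (tilde F).
  move=> hF hG FK GK x; have [al [be [ga [a [b [c ->]]]]]] := herm3P x.
  (* In the entry [b], [F (G b ⊡ (G 1)^⋄) = b ⊡ F 1], and the outer factor [(F 1)^⋄] then
     cancels. *)
  rewrite !tildeE cddiaK !GK cddiaK hati_mul_dia // !GK cddia_scal cdmul1.
  by rewrite hati_oneK.
split.
- move=> s x y; have [al [be [ga [a [b [c ->]]]]]] := herm3P x.
  have [al' [be' [ga' [a' [b' [c' ->]]]]]] := herm3P y.
  rewrite herm3_linearE !tildeE herm3_linearE !cddia_linear.
  by rewrite !(hati_linear hT) cdmul_linearl cddia_linear.
- have [S TK SK] := hati_bij hT; have hS := hati_inv T S hT TK SK.
  by exists (tilde S); apply: tildeK.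
- move=> x y; have [al [be [ga [a [b [c ->]]]]]] := herm3P x.
  have [al' [be' [ga' [a' [b' [c' ->]]]]]] := herm3P y.
  rewrite herm3_jmulE !tildeE herm3_jmulE.
  rewrite (cdform_mul_one_dia T hT) !cdform_dia !(hati_form T hT) !cdform_dia.
  congr (herm3_of _ _ _ _ _ _).
  + by rewrite !(hatiD T hT, hatiZ T hT) !(hati_mul T hT) !cddiaK.
  + rewrite (hatiZ T hT) cdmulZl !(hatiD T hT, hatiZ T hT) !(cdmulDl, cdmulZl).
    (* Writing [c] as [(c^⋄)^⋄] makes [a ⊡ c'] a triple product with last argument 1; its trailing
       [u] cancels against [u^⋄]. *)
    rewrite -{1}[c']cddiaK -{1}[c]cddiaK !(hati_mul_dia T hT).
    by rewrite !(hati_oneK T hT).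
  (* Under [⋄] the product becomes [b'^⋄ ⊡ a], a triple product with first argument 1. *)
  + rewrite !(cddiaZ, cddiaD, cddiaM, cddiaK) !(hatiZ T hT, hatiD T hT).
    by rewrite !(hati_dia_mul T hT) !(cddiaZ, cddiaD, cddiaM, cddiaK).
- move=> x; have [al [be [ga [a [b [c ->]]]]]] := herm3P x.
  rewrite herm3_starE !tildeE herm3_starE.
  (* The factor [u^⋄] in the entry [b] is harmless because [u] is fixed by conjugation. *)
  rewrite cdconjM -!cddia_conj (hati_conj_one T hT) -!(hati_conj hT).
  by rewrite cddia_conj.
Qed.

End Isomorphism.

Theorem proposition7p2 (R : realType) (T : oct R[i] -> oct R[i])
    (hT : hermitian_asymmetric_triple_iso T) :
  jordan_star_automorphism (tilde T : C6 R[i] -> C6 R[i]).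
Proof. exact: tilde_automorphism. Qed.
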